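(* Let $(X,\mathcal{U})$ be a $T_0$ bicomplete quasi-uniform space generated by a family $\mathcal{D}=\{d_\alpha\}_{\alpha\in A}$ of quasi-pseudometrics, and let $T\colon X\to X$ be a $\mathcal{D}$-contraction. Then $T$ has a unique fixed point $x^*\in X$, and $x^*$ is a $\mathcal{U}$-endpoint of $T$ witnessed by $z=x^*$. Moreover, for every $x_0\in X$ the sequence $(T^n x_0)_{n\ge 0}$ converges to $x^*$ in $\mathcal{U}^s$.
   Context: $X$ is a non-empty set. A quasi-uniformity on $X$ is a filter $\mathcal{U}$ on $X\times X$ such that every $U\in\mathcal{U}$ contains the diagonal $\Delta_X$ and for every $U\in\mathcal{U}$ there is $V\in\mathcal{U}$ with $V\circ V\subseteq U$, where $V\circ V=\{(x,z):\exists y,\ (x,y)\in V,\ (y,z)\in V\}$. The pair $(X,\mathcal{U})$ is a quasi-uniform space. Put $U^{-1}=\{(x,y):(y,x)\in U\}$. The symmetrisation $\mathcal{U}^s$ is the uniformity generated by the entourages $U\cap U^{-1}$, $U\in\mathcal{U}$; convergence in $\mathcal{U}^s$ is convergence in its uniform topology. $\mathcal{U}$ is $T_0$ if the preorder $\bigcap\mathcal{U}:=\bigcap_{U\in\mathcal{U}}U$ is antisymmetric. $(X,\mathcal{U})$ is bicomplete if the uniform space $(X,\mathcal{U}^s)$ is complete (every net that is Cauchy for $\mathcal{U}^s$ converges in $\mathcal{U}^s$). A quasi-pseudometric on $X$ is a function $d\colon X\times X\to[0,\infty)$ with $d(x,x)=0$ and $d(x,z)\le d(x,y)+d(y,z)$.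 A family $\mathcal{D}$ of quasi-pseudometrics generates the quasi-uniformity having as subbase the sets $\{(x,y):d(x,y)<\varepsilon\}$, $d\in\mathcal{D}$, $\varepsilon>0$. A self-map $T\colon X\to X$ is a $\mathcal{D}$-contraction if there is a family $\{k_\alpha\}_{\alpha\in A}\subseteq[0,1)$ such that for every $\alpha\in A$ and all $x,y\in X$, $d_\alpha(Tx,Ty)\le k_\alpha d_\alpha(x,y)$ and $d_\alpha(Ty,Tx)\le k_\alpha d_\alpha(y,x)$. For a multivalued map $T\colon X\to 2^X$, a point $x_0$ is a $\mathcal{U}$-endpoint of $T$ witnessed by $z$ if $z\in Tx_0$ and $(z,x_0)\in\bigcap\mathcal{U}$. A single-valued map is regarded as the multivalued map $x\mapsto\{Tx\}$. *)

(* Defs.v *)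
From HB Require Import structures.
From mathcomp Require Import all_boot all_order all_algebra.
From mathcomp Require Import all_classical all_reals.
From mathcomp Require Import topology.

Set Implicit Arguments.
Unset Strict Implicit.
Unset Printing Implicit Defensive.

Import Order.TTheory GRing.Theory Num.Theory.

Local Open Scope classical_set_scope.
Local Open Scope ring_scope.

Record quasiUniformity (X : Type) := QuasiUniformity {
  qu_entourage :> set_system (X * X) ;
  qu_filter : Filter qu_entourage ;
  qu_diagonal : forall V, qu_entourage V -> diagonal `<=` V ;
  qu_split : forall V, qu_entourage V ->
    exists2 W, qu_entourage W & (W \; W)%relation `<=` V }.

(* The carrier of the uniform space (X, U^s); the entourages V `&` V^-1 form a
   filter base because U is a filter. *)
Definition symmetrised (X : choiceType) (U : quasiUniformity X) : Type := X.

Section Symmetrisation.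
Variables (X : choiceType) (U : quasiUniformity X).

Definition sym_entourage : set_system (symmetrised U * symmetrised U) :=
  filter_from U (fun V => V `&` V^-1%relation).

Let sym_filter : Filter sym_entourage.
Proof.
have FU := qu_filter U.
apply: filter_from_filter; first by exists setT; exact: filterT.
move=> V W UV UW; exists (V `&` W); first exact: filterI.
by move=> [x y] /= [[? ?] [? ?]].
Qed.

Let sym_diagonal E : sym_entourage E -> diagonal `<=` E.
Proof.
move=> [V UV VE] [x _] /diagonalP <-; apply: VE.
by split; exact: (qu_diagonal UV).
Qed.

Let sym_inv E : sym_entourage E -> sym_entourage E^-1%relation.
Proof. by move=> [V UV VE]; exists V => // -[x y] /= [? ?]; exact: VE. Qed.

Let sym_split E : sym_entourage E ->
  exists2 F, sym_entourage F & (F \; F)%relation `<=` E.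
Proof.
move=> [V UV VE]; have [W UW WV] := qu_split UV.
exists (W `&` W^-1%relation); first by exists W.
by move=> [x z] /= [y [? ?] [? ?]]; apply: VE; split; apply: WV; exists y.
Qed.

HB.instance Definition _ := Choice.on (symmetrised U).
HB.instance Definition _ := isUniform.Build (symmetrised U)
  sym_filter sym_diagonal sym_inv sym_split.

End Symmetrisation.

Arguments sym_entourage {X} U.

Definition sym_cvg (X : choiceType) (U : quasiUniformity X)
    (F : set_system X) (x : X) : Prop :=
  (F : set_system (symmetrised U)) --> (x : symmetrised U).

Definition directed (I : Type) (le : I -> I -> Prop) : Prop :=
  [/\ inhabited I,
      forall i, le i i,
      forall i j k, le i j -> le j k -> le i k &
      forall i j, exists2 k, le i k & le j k].

Definition net_tails (I : Type) (le : I -> I -> Prop) : set_system I :=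
  filter_from setT (fun i => [set j | le i j]).

Definition cauchy_net (Y : uniformType) (I : Type) (le : I -> I -> Prop)
    (s : I -> Y) : Prop :=
  forall E, entourage E ->
    exists i0, forall i j, le i0 i -> le i0 j -> E (s i, s j).

Definition bicomplete (X : choiceType) (U : quasiUniformity X) : Prop :=
  forall (I : Type) (le : I -> I -> Prop) (s : I -> X),
    directed le -> @cauchy_net (symmetrised U) I le s ->
    exists x, sym_cvg U (s @ net_tails le) x.

Definition specialisation (X : Type) (U : set_system (X * X)) : set (X * X) :=
  \bigcap_(V in U) V.

Definition T0_quasi_uniform (X : Type) (U : quasiUniformity X) : Prop :=
  forall x y, specialisation U (x, y) -> specialisation U (y, x) -> x = y.

Definition quasi_pseudometric (R : realType) (X : Type) (d : X -> X -> R) :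
    Prop :=
  [/\ forall x y, 0 <= d x y,
      forall x, d x x = 0 &
      forall x y z, d x z <= d x y + d y z].

Definition generated_by (R : realType) (X A : Type) (d : A -> X -> X -> R) :
    set_system (X * X) :=
  smallest Filter [set V | exists (a : A) (e : R),
    0 < e /\ V = [set xy | d a xy.1 xy.2 < e]].

Definition D_contraction (R : realType) (X A : Type) (d : A -> X -> X -> R)
    (T : X -> X) : Prop :=
  exists k : A -> R, (forall a, 0 <= k a < 1) /\
    forall a x y, d a (T x) (T y) <= k a * d a x y /\
                  d a (T y) (T x) <= k a * d a y x.

Definition endpoint (X : Type) (U : set_system (X * X)) (T : X -> set X)
    (x0 z : X) : Prop :=
  T x0 z /\ specialisation U (z, x0).

(* Main.v *)
Require Import Defs.
From mathcomp Require Import all_boot all_order all_algebra.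
From mathcomp Require Import all_classical all_reals.
From mathcomp Require Import topology.
From mathcomp Require Import normedtype sequences.
From mathcomp Require Import ring lra.

Set Implicit Arguments.
Unset Strict Implicit.
Unset Printing Implicit Defensive.

Import Order.TTheory GRing.Theory Num.Theory.
Import numFieldNormedType.Exports.

Local Open Scope classical_set_scope.
Local Open Scope ring_scope.

(** Each pseudometric contracts along an orbit in both directions, so the orbit
    is Cauchy for the symmetrisation; bicompleteness provides a limit [x], and
    [d_a(Tx, x) = d_a(x, Tx) = 0] for all [a] forces [Tx = x] by T0. The same
    argument shows that two fixed points coincide, hence all orbits converge
    to the same point. *)

Lemma generated_by_ball (R : realType) (X A : Type) (d : A -> X -> X -> R)
    (a : A) (e : R) :
  0 < e -> generated_by d [set xy | d a xy.1 xy.2 < e].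
Proof. by move=> e0 F [FF GF]; apply: GF; exists a, e. Qed.

(* The image filter of [F] under [f] is one of the filters over which
   [generated_by d] is the intersection. *)
Lemma cvg_generated_by (R : realType) (X A I : Type) (d : A -> X -> X -> R)
    (F : set_system I) (FF : Filter F) (f : I -> X * X) :
  (forall a e, 0 < e -> \forall i \near F, d a (f i).1 (f i).2 < e) ->
  f @ F --> generated_by d.
Proof.
move=> df V; apply; split; first exact: fmap_filter.
by move=> _ [a [e [e0 ->]]]; exact: df.
Qed.

(** A point is treated as a constant family indexed by [unit]: under the filter whose only member is
    the whole index set, eventual membership in an entourage is actual membership. *)
Lemma specialisation_generated_by (R : realType) (X A : Type)
    (d : A -> X -> X -> R) (x y : X) :
  (forall a e, 0 < e -> d a x y < e) -> specialisation (generated_by d) (x, y).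
Proof.
move=> dxy V UV.
have dF a e : 0 < e -> \forall i \near globally [set: unit], d a x y < e.
  by move=> e0 _ _; exact: dxy.
exact: (@cvg_generated_by _ _ _ _ _ _ (globally_filter _) (fun=> (x, y)) dF
  V UV tt I).
Qed.

Lemma T0_quasi_pseudometric_eq (R : realType) (X A : Type)
    (U : quasiUniformity X) (d : A -> X -> X -> R) (x y : X) :
  qu_entourage U = generated_by d -> T0_quasi_uniform U ->
  (forall a e, 0 < e -> d a x y < e) -> (forall a e, 0 < e -> d a y x < e) ->
  x = y.
Proof.
by move=> UE T0 dxy dyx; apply: T0; rewrite UE;
  exact: specialisation_generated_by.
Qed.

Lemma sym_cvg_near (X : choiceType) (U : quasiUniformity X)
    (F : set_system X) (FF : Filter F) (x : X) (V : set (X * X)) :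
  sym_cvg U F x -> qu_entourage U V ->
  \forall y \near F, V (x, y) /\ V (y, x).
Proof.
move=> /cvg_entourageP Fx UV.
have /Fx : @entourage (symmetrised U) (V `&` V^-1%relation) by exists V.
by apply: filterS => y [].
Qed.

Section Orbit.
Context (R : realType) (X : Type) (T : X -> X).
Implicit Types (d : X -> X -> R) (k : R).

Lemma iter_contraction d k : 0 <= k ->
  (forall x y, d (T x) (T y) <= k * d x y) ->
  forall n x y, d (iter n T x) (iter n T y) <= k ^+ n * d x y.
Proof.
move=> k0 dT; elim=> [|n IH] x y; first by rewrite expr0 mul1r.
rewrite !iterS (le_trans (dT _ _))// exprS -mulrA.
exact: ler_wpM2l.
Qed.

(* [d x (T x) + k B = B] for the fixed point [B = d x (T x) / (1 - k)] of the
   recursive bound. *)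
Lemma orbit_bounded d k x : quasi_pseudometric d -> 0 <= k < 1 ->
  (forall x y, d (T x) (T y) <= k * d x y) ->
  forall n, d x (iter n T x) <= d x (T x) / (1 - k).
Proof.
move=> [d0 dxx dtri] /andP[k0 k1] dT; have k1' : 0 < 1 - k by rewrite subr_gt0.
elim=> [|n IH]; first by rewrite dxx divr_ge0// ltW.
rewrite (le_trans (dtri _ (T x) _))//= (le_trans (lerD (lexx _) (dT _ _)))//.
rewrite (le_trans (lerD (lexx _) (ler_wpM2l k0 IH)))// le_eqVlt.
by apply/orP; left; apply/eqP; field; rewrite gt_eqF.
Qed.

(** For [N <= m <= n], pulling out [m] iterations gives [d (T^m x) (T^n x) <= k^m * d x (T^(n-m) x)
    <= k^N * B], which tends to 0. Since [d] is not symmetric, this covers only the order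
    [m <= n]. *)
Lemma orbit_cauchy_le d k x : quasi_pseudometric d -> 0 <= k < 1 ->
  (forall x y, d (T x) (T y) <= k * d x y) ->
  forall e, 0 < e -> \forall N \near \oo, forall m n,
    (N <= m)%N -> (m <= n)%N -> d (iter m T x) (iter n T x) < e.
Proof.
move=> dq k01 dT e e0; have /andP[k0 k1] := k01; have [d0 _ _] := dq.
set B := d x (T x) / (1 - k).
have B0 : 0 <= B by rewrite divr_ge0// subr_ge0 ltW.
have : k ^+ n * B @[n --> \oo] --> (0 : R).
  rewrite -[X in _ --> X](mul0r B); apply: cvgMl.
  by apply: cvg_expr; rewrite ger0_norm.
move=> /(cvgr_lt 0) /(_ _ e0); apply: filterS => N kN m n Nm mn.
apply: le_lt_trans kN; rewrite -(subnKC mn) iterD.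
rewrite (le_trans (iter_contraction k0 dT _ _ _))//.
apply: ler_pM => //; first exact: exprn_ge0.
  by rewrite ler_wiXn2l// ltW.
exact: orbit_bounded.
Qed.

(** At fixed points the contraction reads [d x y <= k * d x y], and [k < 1] leaves only 0. *)
Lemma contraction_fixed_eq0 d k x y : quasi_pseudometric d -> k < 1 ->
  (forall x y, d (T x) (T y) <= k * d x y) ->
  T x = x -> T y = y -> d x y = 0.
Proof.
move=> [d0 _ _] k1 dT Tx Ty; have := dT x y; have := d0 x y.
rewrite Tx Ty; nra.
Qed.

End Orbit.

Lemma quasi_pseudometric_flip (R : realType) (X : Type) (d : X -> X -> R) :
  quasi_pseudometric d -> quasi_pseudometric (fun x y => d y x).
Proof. by move=> [d0 dxx dtri]; split=> // x y z; rewrite addrC. Qed.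

Lemma orbit_cauchy (R : realType) (X : choiceType) (U : quasiUniformity X)
    (A : Type) (d : A -> X -> X -> R) (T : X -> X) (x : X) :
  (forall a, quasi_pseudometric (d a)) ->
  qu_entourage U = generated_by d -> D_contraction d T ->
  @cauchy_net (symmetrised U) nat leq (fun n => iter n T x).
Proof.
move=> dq UE [k [k01 dT]] E [V UV VE].
(* Cauchyness is phrased as convergence of pairs along the product filter, so only the subbasic
   entourages have to be checked. *)
have : \forall mn \near (\oo, \oo), V (iter mn.1 T x, iter mn.2 T x).
  rewrite UE in UV; suff: (fun mn => (iter mn.1 T x, iter mn.2 T x)) @
    (\oo, \oo) --> generated_by d by exact.
  apply: cvg_generated_by => a e e0 /=.
  have [N _ HN] := orbit_cauchy_le x (dq a) (k01 a)
    (fun x y => (dT a x y).1) e0.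
  have [M _ HM] := orbit_cauchy_le x (quasi_pseudometric_flip (dq a)) (k01 a)
    (fun x y => (dT a x y).2) e0.
  exists ([set n | maxn N M <= n]%N, [set n | maxn N M <= n]%N).
    by split; exact: nbhs_infty_ge.
  move=> [m n] /= [Nm Nn]; move: Nm Nn; rewrite !geq_max.
  (* For [n <= m] the one-sided estimate is applied to the flipped distance. *)
  move=> /andP[Nm Mm] /andP[Nn Mn]; have [mn|/ltnW nm] := leqP m n.
    exact: (HN N (leqnn N)).
  exact: (HM M (leqnn M)).
(* Beyond the maximum, both [(i, j)] and [(j, i)] lie in [P] times [Q], which yields membership in
   [V] and in its inverse. *)
move=> [[P Q] [/= [N _ NP] [M _ MQ]] PQV]; exists (maxn N M) => i j.
rewrite !geq_max => /andP[Ni Mi] /andP[Nj Mj]; apply: VE.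
by split; apply: (PQV (_, _)); split; [exact: NP|exact: MQ|exact: NP|exact: MQ].
Qed.

Lemma orbit_limit_fixed (R : realType) (X : choiceType) (U : quasiUniformity X)
    (A : Type) (d : A -> X -> X -> R) (T : X -> X) (x y : X) :
  (forall a, quasi_pseudometric (d a)) ->
  qu_entourage U = generated_by d -> T0_quasi_uniform U -> D_contraction d T ->
  sym_cvg U (iter n T x @[n --> \oo]) y -> T y = y.
Proof.
move=> dq UE T0 [k [k01 dT]] xy.
have dy a e : 0 < e -> d a (T y) y < e /\ d a y (T y) < e.
  move=> e0; have e20 : 0 < e / 2 by rewrite divr_gt0.
  have Ue : qu_entourage U [set xy | d a xy.1 xy.2 < e / 2].
    by rewrite UE; exact: generated_by_ball.
  have [N _ /= xN] := sym_cvg_near _ xy Ue.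
  have [yN Ny] := xN N (leqnn N); have [ySN SNy] := xN N.+1 (leqnSn N).
  have [d0 _ dtri] := dq a; have /andP[k0 k1] := k01 a.
  have [T1 T2] := dT a y (iter N T x).
  (* Going through [T^(N+1) x]: the leg at [T y] is at most [k] times the distance between [y] and
     [T^N x], so each leg is below [e / 2]. Closeness to [y] is used at both [N] and [N+1]. *)
  have := dtri (T y) (iter N.+1 T x) y; have := dtri y (iter N.+1 T x) (T y).
  have := d0 y (iter N T x); have := d0 (iter N T x) y.
  rewrite /= in yN Ny ySN SNy *; nra.
by apply: (T0_quasi_pseudometric_eq UE T0) => a e e0; have [] := dy a e e0.
Qed.

Theorem corollary5p5 (R : realType) (X : choiceType) (X_nonempty : [set: X] !=set0)
    (U : quasiUniformity X) (A : Type) (d : A -> X -> X -> R) (T : X -> X) :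
  (forall a, quasi_pseudometric (d a)) ->
  qu_entourage U = generated_by d ->
  T0_quasi_uniform U ->
  bicomplete U ->
  D_contraction d T ->
  exists xs : X,
    [/\ unique (fun x => T x = x) xs,
        endpoint U (fun x => [set T x]) xs xs &
        forall x0 : X, sym_cvg U (iter n T x0 @[n --> \oo]) xs].
Proof.
move=> dq UE T0 bic DT.
have orbit_limit x0 : exists2 x, T x = x & sym_cvg U (iter n T x0 @[n --> \oo]) x.
  have dir : directed leq.
    split; [exact: (inhabits 0%N)|exact: leqnn|move=> i j l; exact: leq_trans|].
    by move=> i j; exists (maxn i j); rewrite ?leq_maxl ?leq_maxr.
  have [x xx] := bic _ _ _ dir (orbit_cauchy x0 dq UE DT).
  (* The tails of the net [leq] on the naturals are, by conversion, the filter [\oo]. *)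
  by exists x => //; exact: orbit_limit_fixed xx.
have fixed_eq x y : T x = x -> T y = y -> x = y.
  have [k [k01 dT]] := DT => Tx Ty.
  have d0 a u v : T u = u -> T v = v -> d a u v = 0.
    have /andP[_ k1] := k01 a.
    exact: contraction_fixed_eq0 (dq a) k1 (fun u v => (dT a u v).1).
  by apply: (T0_quasi_pseudometric_eq UE T0) => a e; rewrite d0.
have [x0 _] := X_nonempty; have [xs Txs _] := orbit_limit x0.
exists xs; split.
- by split=> // y; exact: fixed_eq.
- split; first by rewrite /= Txs.
  by move=> V UV; exact: (qu_diagonal UV).
- by move=> y; have [x Tx yx] := orbit_limit y; rewrite (fixed_eq _ _ Txs Tx).
Qed.
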